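(* No two-variable polynomial equation is Ramsey PR. That is, for every nonzero polynomial $P\in\mathbb Z[x,y]$, the formula $P(x,y)=0$ is not Ramsey PR in $(x,y)$.
   Context: $\mathbb N$ is the set of positive integers. A formula $\varphi(x,y)$ on $\mathbb N$ is Ramsey partition regular (Ramsey PR) in $(x,y)$ if for all finite colourings $\mathbb N=C_1\cup\ldots\cup C_r$ there are a colour $i\le r$ and an infinite set $H\subseteq C_i$ such that $\varphi(h_1,h_2)$ holds for all $h_1<h_2$ in $H$. *)

(* Defs.v *)
From mathcomp Require Import all_boot all_order all_algebra.
From mathcomp Require Import boolp classical_sets functions cardinality.
From mathcomp Require Import mpoly.

Set Implicit Arguments.
Unset Strict Implicit.
Unset Printing Implicit Defensive.

Local Open Scope classical_set_scope.

Definition posnats : set nat := [set n | (0 < n)%N].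

(* Some colour classes may be empty. *)
Definition finite_colouring (r : nat) (C : 'I_r -> set nat) : Prop :=
  \bigcup_i C i = posnats /\ trivIset setT C.

(* Only the values of phi on positive integers matter, since H is contained in
   a colour class and hence in posnats. *)
Definition Ramsey_PR (phi : nat -> nat -> Prop) : Prop :=
  forall (r : nat) (C : 'I_r -> set nat), finite_colouring C ->
  exists (i : 'I_r) (H : set nat),
    [/\ H `<=` C i, infinite_set H &
        forall h1 h2, H h1 -> H h2 -> (h1 < h2)%N -> phi h1 h2].

Definition eval2 (P : {mpoly int[2]}) (x y : int) : int :=
  P.@[tnth [tuple x; y]].

(* Main.v *)
Require Import Defs.
From mathcomp Require Import all_boot all_order all_algebra.
From mathcomp Require Import boolp classical_sets functions cardinality.
From mathcomp Require Import mpoly.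
From mathcomp Require Import finmap.

Import GRing.Theory.

Local Open Scope ring_scope.

(** If [H] is infinite and [P(h1, h2) = 0] for all [h1 < h2] in [H], then for
    each [h1] in [H] the polynomial [P(h1, y)] has infinitely many roots, so
    all its coefficients vanish; these coefficients are polynomials in [h1]
    with infinitely many roots, so they are zero. Hence a single colour already
    refutes Ramsey partition regularity. *)

(** A nonzero [p] has fewer than [size p] roots, while [A] supplies at least [size p] distinct
    ones. *)
Lemma poly_eq0_infinite_roots (p : {poly int}) (A : set nat) :
  infinite_set A -> (forall n : nat, A n -> p.[n%:Z] = 0) -> p = 0.
Proof.
move=> infA rootA.
have [B BA szB] := infinite_set_fset (size p) infA.
apply: (@roots_geq_poly_eq0 _ p [seq n%:Z | n <- B]); last by rewrite size_map.
- by apply/allP => _ /mapP[n Bn ->]; apply/rootP/rootA/BA.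
- by rewrite map_inj_uniq ?fset_uniq // => m n [].
Qed.

(** Needed because the equation is only known for [h1 < h2]: fixing [h1] must still leave infinitely
    many roots in [y]. *)
Lemma infinite_set_gt (A : set nat) (n : nat) :
  infinite_set A -> infinite_set (A `&` [set m | (n < m)%N])%classic.
Proof.
move=> infA; have := infinite_setD infA (finite_II n.+1).
congr (~ finite_set _); apply/seteqP; split=> m /= [Am].
- by rewrite ltnS => /negP; rewrite -ltnNge.
- by move=> ltnm; split=> //; apply/negP; rewrite ltnS -ltnNge.
Qed.

Lemma eval2E (P : {mpoly int[2]}) (x y : int) :
  eval2 P x y =
  \sum_(m <- msupp P) P@_m * x ^+ m ord0 * y ^+ m ord_max.
Proof.
rewrite /eval2 mevalE; apply: eq_bigr => m _.
rewrite big_ord_recl big_ord1 mulrA.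
by congr (_ * _ ^+ m _ * _ ^+ m _); apply: val_inj.
Qed.

(** The exponents [d i] may repeat, so a coefficient collects several terms. The filter [Q] lets the
    [x]-exponent be extracted after the [y]-exponent has been fixed. *)
Lemma coef_sum_scaleXn (I : Type) (s : seq I) (Q : pred I) (c : I -> int)
    (d : I -> nat) (k : nat) :
  (\sum_(i <- s | Q i) c i *: 'X^(d i))`_k =
  \sum_(i <- s | Q i && (d i == k)) c i.
Proof.
rewrite coef_sum big_mkcondr; apply: eq_bigr => i _.
by rewrite coefZ coefXn eq_sym; case: eqP => _; rewrite ?mulr1 ?mulr0.
Qed.

Lemma horner_sum_scaleXn (I : Type) (s : seq I) (Q : pred I) (c : I -> int)
    (d : I -> nat) (x : int) :
  (\sum_(i <- s | Q i) c i *: 'X^(d i)).[x] =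
  \sum_(i <- s | Q i) c i * x ^+ d i.
Proof.
by rewrite horner_sum; apply: eq_bigr => i _; rewrite hornerZ hornerXn.
Qed.

Lemma mpoly2_eq0_infinite (P : {mpoly int[2]}) (H : set nat) :
  infinite_set H ->
  (forall h1 h2 : nat, H h1 -> H h2 -> (h1 < h2)%N ->
    eval2 P h1%:Z h2%:Z = 0) ->
  P = 0.
Proof.
move=> infH PH.
(* This sum is the coefficient of [y ^ b] in [P(h, y)]. *)
have coefy (b h : nat) : H h ->
    \sum_(m <- msupp P | m ord_max == b) P@_m * h%:Z ^+ m ord0 = 0.
  move=> Hh.
  have /(congr1 (fun p : {poly int} => p`_b)) :
      \sum_(m <- msupp P) (P@_m * h%:Z ^+ m ord0) *: 'X^(m ord_max) = 0.
    apply: (poly_eq0_infinite_roots _ _ (infinite_set_gt _ h infH)).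
    by move=> k [Hk hk]; rewrite horner_sum_scaleXn -eval2E PH.
  by rewrite coef_sum_scaleXn coef0.
apply/mpolyP => m; rewrite mcoeff0.
have [mP|/memN_msupp_eq0 //] := boolP (m \in msupp P).
(* The coefficient of [y ^ m ord_max] in [P], now as a polynomial in [x], vanishes on all of [H] by
   [coefy]. *)
have /(congr1 (fun p : {poly int} => p`_(m ord0))) :
    \sum_(k <- msupp P | k ord_max == m ord_max) P@_k *: 'X^(k ord0) = 0.
  apply: (poly_eq0_infinite_roots _ _ infH) => h Hh.
  by rewrite horner_sum_scaleXn coefy.
(* Two exponents determine a monomial and the support has no repetitions, so only [m] contributes
   and the sum is [P@_m]. *)
rewrite coef_sum_scaleXn coef0 (big_rem m) //= !eqxx /= big_seq_cond big1 ?addr0 //.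
move=> k /andP[krem /andP[/eqP k1 /eqP k0]].
suff km : k = m by move: krem; rewrite km mem_rem_uniqF.
apply/mnmP => i; have [->|->] // : i = ord0 \/ i = ord_max.
by case: i => [[|[|//]] ?]; [left|right]; apply: val_inj.
Qed.

Theorem proposition5p2 (P : {mpoly int[2]}) (hP : P != 0) :
  ~ Ramsey_PR (fun x y : nat => eval2 P x%:Z y%:Z = 0).
Proof.
move=> PR.
have [|i [H [_ infH PH]]] := PR 1%N (fun=> posnats).
  split; last by move=> i j _ _ _; rewrite (ord1 i) (ord1 j).
  by apply/seteqP; split=> n; [case|exists ord0].
by move/eqP: hP; apply; exact: mpoly2_eq0_infinite infH PH.
Qed.
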